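(* Let $\{X(t)\}_{t\ge 0}$ be the real-valued Lévy process with $\mathbb{E}[e^{iyX(t)}]=\exp(t\psi(y))$ for all $t\ge0$, $y\in\mathbb{R}$, where $$\psi(y)=\int_{0+}^\infty \left(e^{iyx}-1-iyx\,1_{\{x\le 1\}}\right)d\phi(x)$$ and the Lévy measure $\phi$ is concentrated on $\{2^k:k\in\mathbb{Z}\}$ with $\phi(\{2^k\})=2^{-k}$. For $t\in[\frac12,1]$ let $Y(t)=t^{-1}(X(t)-t\log_2 t)$, and let $Y([\frac12,1])=\{Y(t):t\in[\frac12,1]\}\subseteq\mathbb{R}$ be the range. Then almost surely the box-counting dimension of $Y([\frac12,1])$ exists and $$\dim_{\rm B} Y([\tfrac12,1])=1.$$
   Context: For a bounded set $F\subseteq\mathbb{R}^d$ let $N_\delta(F)$ be the smallest number of closed balls of radius $\delta$ that cover $F$; the box-counting dimension is $\dim_{\rm B}F=\lim_{\delta\to0}\frac{\log N_\delta(F)}{-\log\delta}$, provided the limit exists. $\log_2$ is the logarithm to base $2$. Explicitly, $\psi(y)=\sum_{k\in\mathbb{Z}}2^{-k}\left(e^{iy2^k}-1-iy2^k1_{\{k\le 0\}}\right)$. A Lévy process starts at $0$, has stationary independent increments and càdlàg sample paths. *)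

(* Defs.v *)
From HB Require Import structures.
From mathcomp Require Import all_boot all_order all_algebra.
From mathcomp Require Import complex.
From mathcomp Require Import all_classical all_reals all_analysis.

Set Implicit Arguments.
Unset Strict Implicit.
Unset Printing Implicit Defensive.

Import Order.TTheory GRing.Theory Num.Theory.
Import numFieldNormedType.Exports.

Local Open Scope classical_set_scope.
Local Open Scope complex_scope.
Local Open Scope ring_scope.

Definition cexp (R : realType) (z : R[i]) : R[i] :=
  (expR (complex.Re z))%:C * (cos (complex.Im z) +i* sin (complex.Im z)).

(* Integral of a complex-valued function, componentwise; meaningful when both
   components are integrable, since Rintegral is total. *)
Definition Cintegral d (T : measurableType d) (R : realType)
    (mu : {measure set T -> \bar R}) (D : set T) (f : T -> R[i]) : R[i] :=
  (\int[mu]_(x in D) complex.Re (f x)) +i* (\int[mu]_(x in D) complex.Im (f x)).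

Definition charfun d (T : measurableType d) (R : realType)
    (P : probability T R) (Z : T -> R) (y : R) : R[i] :=
  Cintegral P [set: T] (fun w => cexp ('i * (y * Z w)%:C)).

(* Each B i ranges over all Borel sets, [set: R] included, so the product rule
   for the whole family contains the one for every subfamily. *)
Definition mutually_independent d (T : measurableType d) (R : realType)
    (P : probability T R) (n : nat) (Z : 'I_n -> T -> R) : Prop :=
  forall B : 'I_n -> set R, (forall i, measurable (B i)) ->
    P (\bigcap_(i in [set: 'I_n]) (Z i @^-1` B i))
    = (\prod_(i < n) P (Z i @^-1` B i))%E.

Definition cadlag (R : realType) (f : R -> R) : Prop :=
  (forall t, 0 <= t -> f s @[s --> t^'+] --> f t) /\
  (forall t, 0 < t -> cvg (f s @[s --> t^'-])).

(* The time parameter is a real number; only X t with 0 <= t matters. *)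
Record levy_process d (T : measurableType d) (R : realType)
    (P : probability T R) (X : R -> {RV P >-> R}) : Prop := LevyProcess {
  levy_start : {ae P, forall w, X 0 w = 0};
  levy_independent_increments :
    forall (n : nat) (t : nat -> R), 0 <= t 0%N ->
      (forall i j, (i <= j)%N -> t i <= t j) ->
      mutually_independent P (fun (i : 'I_n) w => X (t i.+1) w - X (t i) w);
  levy_stationary_increments :
    forall s h : R, 0 <= s -> 0 <= h ->
      forall B : set R, measurable B ->
        P ((fun w => X (s + h) w - X s w) @^-1` B)
        = P ((fun w => X h w - X 0 w) @^-1` B);
  levy_cadlag : {ae P, forall w, cadlag (fun t => X t w)}
}.

Definition log2 (R : realType) (x : R) : R := ln x / ln 2.

(* The characteristic exponent of the Levy measure phi; the integral from 0+
   to infinity excludes 0. *)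
Definition levy_exponent (R : realType) (phi : {measure set R -> \bar R})
    (y : R) : R[i] :=
  Cintegral phi `]0, +oo[ (fun x =>
    cexp ('i * (y * x)%:C) - 1 - 'i * (y * x * (x <= 1)%R%:R)%:C).

Definition dyadic_levy_measure (R : realType)
    (phi : {measure set R -> \bar R}) : Prop :=
  phi (~` range (fun k : int => 2 ^ k : R)) = 0%E /\
  forall k : int, phi [set (2 ^ k : R)] = (2 ^ (- k) : R)%:E.

Section box_dimension.
Context (R : realType) (V : normedModType R).

Definition ball_coverable (F : set V) (delta : R) (n : nat) : Prop :=
  exists c : 'I_n -> V,
    F `<=` \bigcup_(i in [set: 'I_n]) closed_ball (c i) delta.

(* The smallest number of closed balls of radius delta covering F, for F
   admitting a finite such cover; an arbitrary number otherwise. *)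
Definition covering_number (F : set V) (delta : R) : nat :=
  get [set n | ball_coverable F delta n /\
               forall m, ball_coverable F delta m -> (n <= m)%N].

Definition box_ratio (F : set V) (delta : R) : R :=
  ln (covering_number F delta)%:R / - ln delta.

Definition box_dim_exists (F : set V) : Prop :=
  bounded_set F /\ cvg (box_ratio F delta @[delta --> 0^'+]).

Definition box_dim (F : set V) : R :=
  lim (box_ratio F delta @[delta --> 0^'+]).

End box_dimension.

(* Main.v *)
(** Anti-concentration plus a second-moment count of close pairs. At a positive integer [m] a
    single atom of the Lévy measure, of size about [1/m] and mass about [m], already gives
    [Re psi(m) <= - kappa m], so that the characteristic function of [X h] is at most
    [exp (- kappa h m)] in modulus; integrating a Fejér sum yields
    [P (|X h - b| <= 1/N) <= K / (N h)] uniformly in [b]. By independence of increments the same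
    bound holds for [Y t - Y s], whose dependence on [X t - X s] is through a factor [1/t >= 1].
    Among [2^n] equally spaced times the expected number of pairs at which [Y] is [2^-n]-close is
    therefore [O(n 2^n)], and by Borel-Cantelli it is almost surely eventually below
    [2^n (n+1)^2 (n+2)]. By Cauchy-Schwarz a cover by [N] balls of radius [2^-(n+1)] produces at
    least [4^n / N] such pairs, so the covering numbers are at least [2^n / (n+2)^3]; the upper
    bound on the dimension only uses that càdlàg paths are bounded on compact intervals. *)

Require Import Defs.
From HB Require Import structures.
From mathcomp Require Import all_boot all_order all_algebra.
From mathcomp Require Import complex.
From mathcomp Require Import all_classical all_reals all_analysis.
From mathcomp Require Import measurable_realfun ring lra zify.

Import Order.TTheory GRing.Theory Num.Theory.
Import numFieldNormedType.Exports.

Local Open Scope classical_set_scope.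
Local Open Scope complex_scope.
Local Open Scope ring_scope.

Set Implicit Arguments.
Unset Strict Implicit.
Unset Printing Implicit Defensive.

(** * Elementary bounds on sine and cosine *)

Section Trigonometry.
Variable R : realType.
Implicit Types x y r : R.

Lemma cexp_iE r : cexp ('i * r%:C) = cos r +i* sin r.
Proof.
by rewrite /cexp; simpc; rewrite /= expR0 !mul1r.
Qed.

Lemma ler_norm_sin x : `|sin x| <= `|x|.
Proof.
wlog x0 : x / 0 <= x => [H|].
  case: (leP 0 x) => [|/ltW x0]; first exact: H.
  by rewrite -[sin x]opprK normrN -sinN -(normrN x); apply: H; rewrite oppr_ge0.
have [c _] : exists2 c, c \in `[0, x] & sin x - sin 0 = cos c * (x - 0).
  apply: MVT_segment => //.
  by apply: continuous_subspaceT => z; exact: continuous_sin.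
rewrite sin0 !subr0 => ->.
by rewrite normrM ler_piMl // cos_max.
Qed.

Lemma onemcos_ge0 x : 0 <= 1 - cos x.
Proof. by rewrite subr_ge0 cos_le1. Qed.

Lemma onemcos_le2 x : 1 - cos x <= 2.
Proof. by have := cos_geN1 x; lra. Qed.

(** Half-angle formula: [1 - cos x] equals [2 sin(x/2)^2]. The quadratic bound controls the
    infinitely many small atoms of the Lévy measure. *)
Lemma onemcos_le_sqr x : 1 - cos x <= x ^+ 2.
Proof.
have {1}-> : x = (x / 2) *+ 2 by rewrite -mulr_natr divfK.
rewrite cos_mulr2n cos2sin2.
have : sin (x / 2) ^+ 2 <= (x / 2) ^+ 2.
  rewrite -(ger0_norm (sqr_ge0 (sin _))) -(ger0_norm (sqr_ge0 (x / 2))) !normrX.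
  by rewrite ler_sqr ?nnegrE // ler_norm_sin.
have := sqr_ge0 x; rewrite !expr2; nra.
Qed.

Lemma cos1_lt1 : cos 1 < 1 :> R.
Proof.
rewrite -[X in _ < X]cos0 ltr_cos // in_itv /= ?lexx ?pi_ge0 //.
by rewrite ler01 (le_trans _ (pi_ge2 R)) // ler1n.
Qed.

(** Here and in [ger_cos1], cosine decreases on [[0, pi]], which contains 2. This bound serves the
    Fejér sum, the next one the Lévy integral. *)
Lemma ler_cos1 x : `|x| <= 1 -> cos 1 <= cos x.
Proof.
move=> x1; rewrite -(cos_norm x) leNgt; apply/negP.
rewrite ltr_cos ?in_itv /= ?normr_ge0 ?ler01 ?(le_trans x1) ?(le_trans _ (pi_ge2 R)) ?ler1n //.
by rewrite ltNge x1.
Qed.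

Lemma ger_cos1 x : 1 <= x <= 2 -> cos x <= cos 1.
Proof.
move=> /andP[x1 x2]; rewrite leNgt; apply/negP.
rewrite ltr_cos ?in_itv /= ?ler01 ?(le_trans x2 (pi_ge2 R)) ?(le_trans _ (pi_ge2 R)) ?ler1n
  ?(le_trans _ x1) ?ler01 //.
by rewrite ltNge x1.
Qed.

End Trigonometry.

(** * Integrals against the dyadic Lévy measure *)

Section AtomicIntegrals.
Variable R : realType.
Local Open Scope ereal_scope.

(** Injectivity of [u] makes the range a disjoint union of atoms. *)
Lemma ge0_integral_range (mu : {measure set R -> \bar R}) (u : nat -> R)
    (f : R -> \bar R) : injective u -> measurable_fun [set: R] f ->
    (forall x, 0 <= f x) ->
  \int[mu]_(x in range u) f x = \sum_(0 <= n <oo) f (u n) * mu [set u n].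
Proof.
move=> uI mf f0.
have -> : range u = \bigcup_n [set u n].
  by apply/seteqP; split=> [_ [n _ <-]|x [n _ ->]]; exists n.
rewrite ge0_integral_bigcup //; last 2 first.
- exact: measurable_funS mf.
- by move=> i j _ _ [x [/= -> /uI]].
apply: eq_eseriesr => n _.
rewrite (eq_integral (cst (f (u n)))) ?integral_cst //.
by move=> x /[!inE] ->.
Qed.

Lemma nneseries_geometric_lty (c : R) (a : nat -> \bar R) :
  (forall n, 0 <= a n) -> (forall n, a n <= (c / (2 ^ n.+1)%:R)%:E) ->
  \sum_(0 <= n <oo) a n < +oo.
Proof.
move=> a0 ac.
apply: (@le_lt_trans _ _ (\sum_(0 <= n <oo) (c / (2 ^ (n + 1))%:R)%:E)).
  by apply: lee_nneseries => // n _; rewrite addn1.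
have /cvg_lim := @cvg_geometric_eseries_half R c 0.
by rewrite /eseries => -> //; exact: ltry.
Qed.

End AtomicIntegrals.

Section DyadicLevyExponent.
Variables (R : realType) (phi : {measure set R -> \bar R}).
Hypothesis hphi : dyadic_levy_measure phi.

Let f (y : R) x := (1 - cos (y * x))%:E.

Let f_ge0 y x : (0 <= f y x)%E.
Proof. by rewrite lee_fin onemcos_ge0. Qed.

Let mf y : measurable_fun [set: R] (f y).
Proof.
apply/measurable_EFinP; apply: measurable_funB => //.
apply: measurableT_comp; last exact: measurable_funM.
by apply: continuous_measurable_fun; exact: continuous_cos.
Qed.

(* Needed because [levy_exponent] is built on [Rintegral], which is [0] on infinite integrals. *)
Lemma dyadic_levy_measure_onemcos_fin y :
  (\int[phi]_(x in `]0%R, +oo[) (1 - cos (y * x))%:E < +oo)%E.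
Proof.
have [hN hA] := hphi.
(* The atoms [2^k] with [k >= 0] and with [k < 0], matching the constructors [Posz n] and
   [Negz n]. *)
pose u n : R := 2 ^+ n; pose v n : R := (2 ^+ n.+1)^-1.
have uI : injective u by apply: ieexprIn; rewrite // pnatr_eq1.
have vI : injective v.
  by move=> i j /invr_inj /uI [].
have mrange w : measurable (range (w : nat -> R)).
  by apply: countable_measurable => //; exact: card_image_le.
have rE : range (fun k : int => 2 ^ k : R) = range u `|` range v.
  apply/seteqP; split => [_ [[n|n] _ <-]|x [[n _ <-]|[n _ <-]]].
  - by left; exists n.
  - by right; exists n.
  - by exists (Posz n).
  - by exists (Negz n).
rewrite rE in hN.
have mN : measurable (~` (range u `|` range v)) by apply: measurableC; exact: measurableU.
apply: (@le_lt_trans _ _ (\int[phi]_x f y x)%E).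
  by apply: ge0_subset_integral => //; exact: mf.
rewrite (ge0_negligible_integral mN) // setTD setCK.
rewrite ge0_integral_setU //; first last.
- rewrite disj_set2E; apply/eqP/seteqP; split => // _ [[i _ <-] [j _]] /eqP.
  apply/negP; rewrite lt_eqF // (@lt_le_trans _ _ 1) ?exprn_ege1 ?ler1n //.
  by rewrite invf_lt1 ?exprn_egt1 ?exprn_gt0 ?ltr1n.
- exact: measurable_funS (mf y).
rewrite !ge0_integral_range //.
apply: lte_add_pinfty.
(* Large atoms: [1 - cos <= 2] against the mass [2^-n] gives [4 / 2^(n+1)]. *)
- apply: (@nneseries_geometric_lty _ 4) => n.
    by rewrite mule_ge0.
  have -> : phi [set u n] = ((2 ^+ n)^-1)%:E by apply: (eq_trans (hA (Posz n))); rewrite -invr_expz.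
  rewrite -EFinM lee_fin natrX exprS invfM mulrA.
  rewrite ler_wpM2r ?invr_ge0 ?exprn_ge0 // (le_trans (onemcos_le2 _)) //; lra.
(* Small atoms: [(y v)^2] with [v = 2^-(n+1)], against the mass [2^(n+1)], gives [y^2 / 2^(n+1)]. *)
- apply: (@nneseries_geometric_lty _ (y^+2)) => n.
    by rewrite mule_ge0.
  have -> : phi [set v n] = (2 ^+ n.+1)%:E by apply: (eq_trans (hA (Negz n))).
  have vp : 0 < 2 ^+ n.+1 :> R by rewrite exprn_gt0.
  rewrite -EFinM lee_fin natrX ler_pdivlMr // -mulrA -expr2.
  rewrite (le_trans (ler_wpM2r (sqr_ge0 _) (onemcos_le_sqr _))) //.
  by rewrite /v exprMn exprVn -mulrA mulVf ?mulr1 // expf_neq0 // gt_eqF.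
Qed.

Lemma dyadic_levy_measure_onemcos_ge (m : nat) : (0 < m)%N ->
  (((1 - cos 1) / 2 * m%:R)%:E <= \int[phi]_(x in `]0%R, +oo[) (1 - cos (m%:R * x))%:E)%E.
Proof.
move=> m0; have [_ hA] := hphi.
(* The atom at [2^-e] has mass [2^e > m / 2], and [m * 2^-e] lies in [1, 2]. *)
set e := trunc_log 2 m.
have xp : 0 < (2 ^ (- e%:Z) : R) by rewrite exprz_gt0.
apply: (@le_trans _ _ (\int[phi]_(x in [set (2 ^ (- e%:Z) : R)]) f m%:R x)%E); last first.
  apply: ge0_subset_integral => //.
  - exact: measurable_funS (mf _).
  - by move=> _ ->; rewrite /= in_itv /= xp.
rewrite (eq_integral (cst (f m%:R (2 ^ (- e%:Z))))); last by move=> x /[!inE] ->.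
rewrite integral_cst // hA opprK -EFinM lee_fin.
have e1 : (2 ^ e <= m)%N by rewrite trunc_logP.
have e2 : (m < 2 ^ e.+1)%N by rewrite trunc_log_ltn.
have ep : 0 < 2 ^+ e :> R by rewrite exprn_gt0.
have E : (2 ^ (- e%:Z) : R) = (2 ^+ e)^-1 by rewrite -invr_expz.
have e1' : 2 ^+ e <= m%:R :> R by rewrite -natrX ler_nat.
have e2' : m%:R <= 2 * 2 ^+ e :> R by rewrite -exprS -natrX ler_nat ltnW.
have cle : cos (m%:R * 2 ^ (- e%:Z)) <= cos 1 :> R.
  apply: ger_cos1; rewrite E ler_pdivlMr // ler_pdivrMr // mul1r.
  by rewrite e1' e2'.
have := cos1_lt1 R; rewrite -exprnP; nra.
Qed.

(** The compensator is purely imaginary, so the real part of the integrand is [cos (m x) - 1];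
    finiteness of its integral lets [fine] preserve the lower bound on [1 - cos]. *)
Lemma Re_levy_exponent_le (m : nat) : (0 < m)%N ->
  complex.Re (levy_exponent phi m%:R) <= - ((1 - cos 1) / 2 * m%:R).
Proof.
move=> m0.
rewrite /levy_exponent /Cintegral /=.
rewrite /Rintegral (eq_integral (fun x => - f m%:R x)%E); last first.
  move=> x _; congr (_%:E).
  by rewrite !(mul0r, mulr0, mul1r, oppr0, addr0, add0r) expR0 mul1r opprB.
rewrite integral_ge0N // fineN lerN2.
rewrite -lee_fin fineK ?dyadic_levy_measure_onemcos_ge //.
by rewrite ge0_fin_numE ?integral_ge0 // dyadic_levy_measure_onemcos_fin.
Qed.
End DyadicLevyExponent.

(** * Sums over pairs of indices and the Fejér sum *)

Section DoubleSum.
Variable R : realType.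

(* Truncated subtraction makes [j - k + (k - j)] the distance of [j] and [k]. *)
Lemma sum_dist_le (f : nat -> R) (N : nat) : (forall m, 0 <= f m) ->
  \sum_(j < N) \sum_(k < N) f (j - k + (k - j))%N <= 2 * N%:R * \sum_(m < N) f m.
Proof.
move=> f0.
have H (j : 'I_N) : \sum_(k < N) f (j - k + (k - j))%N <= 2 * \sum_(m < N) f m.
  rewrite -!(big_mkord xpredT).
  rewrite -(big_mkord xpredT (fun k => f (j - k + (k - j))%N)).
  (* The [k < j] realise the distances [1, ..., j], the [k >= j] the distances [0, ..., N - j - 1];
     each part is at most the full sum, whence the factor 2. *)
  rewrite (big_cat_nat (n := j)) //=; last exact: ltnW.
  rewrite mulr_natl mulr2n; apply: lerD.
    rewrite big_nat_rev /= add0n.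
    rewrite (eq_big_nat _ _ (F2 := fun k => f k.+1)); last first.
      by move=> k /andP[_ kj]; congr f; lia.
    rewrite -(big_add1 _ _ 0 j.+1 xpredT f).
    rewrite [leRHS](big_cat_nat (n := j.+1)) //=.
    rewrite [X in _ <= X + _](big_cat_nat (n := 1)) //=.
    rewrite -addrA addrCA lerDl addr_ge0 // ; exact: sumr_ge0.
  rewrite -{1}[nat_of_ord j]add0n big_addn.
  rewrite (eq_big_nat _ _ (F2 := f)); last first.
    by move=> k /andP[_ kj]; congr f; lia.
  rewrite [leRHS](big_cat_nat (n := N - j)) //= ?leq_subr //.
  rewrite lerDl; exact: sumr_ge0.
apply: (le_trans (ler_sum _ (fun j _ => H j))).
by rewrite sumr_const card_ord -[leLHS]mulr_natr mulrAC.
Qed.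

Lemma sum_expr_le (q : R) (N : nat) : 0 <= q < 1 -> \sum_(m < N) q ^+ m <= (1 - q)^-1.
Proof.
move=> /andP[q0 q1].
have q1' : 0 < 1 - q by rewrite subr_gt0.
rewrite -div1r ler_pdivlMr // mulrC -opprB mulNr -subrX1 opprB.
by rewrite lerBlDr lerDl exprn_ge0.
Qed.

Lemma cos_dist (i j : nat) (x : R) :
  cos (i%:R * x) * cos (j%:R * x) + sin (i%:R * x) * sin (j%:R * x)
  = cos ((i - j + (j - i))%N%:R * x).
Proof.
rewrite -cosB -mulrBl; case: (leqP j i) => [ji|/ltnW ij].
  by rewrite -natrB // (eqP ji) addn0.
by rewrite -cosN -mulNr opprB -natrB // (eqP ij).
Qed.

(* Both sides are the squared modulus of [\sum_(j < N) exp (i j x)]. *)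
Lemma fejer_sumE (N : nat) (x : R) :
  \sum_(j < N) \sum_(k < N) cos ((j - k + (k - j))%N%:R * x) =
  (\sum_(j < N) cos (j%:R * x)) ^+ 2 + (\sum_(j < N) sin (j%:R * x)) ^+ 2.
Proof.
rewrite !expr2 !big_distrlr /= -big_split /=; apply: eq_bigr => j _.
by rewrite -big_split /=; apply: eq_bigr => k _; rewrite -cos_dist.
Qed.

(** All angles [j x] lie in [[-1, 1]], so every cosine is at least [cos 1 > 0]; the squared sine sum
    is dropped. *)
Lemma fejer_sum_ge (N : nat) (x : R) : N%:R * `|x| <= 1 ->
  (N%:R * cos 1) ^+ 2 <= \sum_(j < N) \sum_(k < N) cos ((j - k + (k - j))%N%:R * x).
Proof.
move=> Nx; rewrite fejer_sumE.
have c1 : N%:R * cos 1 <= \sum_(j < N) cos (j%:R * x).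
  rewrite mulr_natl -[X in _ *+ X](card_ord N) -sumr_const; apply: ler_sum => j _.
  apply: ler_cos1; rewrite normrM (le_trans _ Nx) // ler_wpM2r // ger0_norm //.
  by rewrite ler_nat ltnW.
have c0 : 0 <= N%:R * cos 1 :> R by rewrite mulr_ge0 // ltW // cos1_gt0.
rewrite (@le_trans _ _ ((\sum_(j < N) cos (j%:R * x)) ^+ 2)) //.
  by rewrite ler_sqr ?nnegrE // (le_trans c0).
by rewrite lerDl sqr_ge0.
Qed.

End DoubleSum.

(** * Small-ball estimates, from one random variable to the increments of [Y] *)

Lemma measurable_norm_le1 d (T : measurableType d) (R : realType) (f : T -> R) (r : R) :
  measurable_fun [set: T] f -> measurable [set w | r * `|f w| <= 1].
Proof.
move=> mf; have -> : [set w | r * `|f w| <= 1] =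
    setT `&` (fun w => r * `|f w|) @^-1` `]-oo, 1].
  by apply/seteqP; split => w /=; rewrite in_itv /=; [split|case].
apply: (_ : measurable_fun setT _) => //.
by apply: measurable_funM => //; exact: measurableT_comp.
Qed.

Section SmallBall.
Context (R : realType) d (T : measurableType d) (P : probability T R).

Lemma bounded_RV_integrable (f : T -> R) (c : R) : measurable_fun [set: T] f ->
  (forall w, `|f w| <= c) -> P.-integrable [set: T] (EFin \o f).
Proof.
move=> mf fc; apply: measurable_bounded_integrable => //.
  by rewrite (le_lt_trans (probability_le1 _ _)) // ltry.
exists c; split; first exact: num_real.
by move=> M cM w _ /=; rewrite (le_trans (fc w)) // ltW.
Qed.

(** Markov's inequality for the Fejér sum [F] in [Z - b]: on the event it is at least [(N cos 1)^2],
    while its mean is at most a double sum of [q ^+ |j - k|], hence at most [2 N / (1 - q)]. *)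
Lemma small_ball_le (Z : T -> R) (q b : R) (N : nat) :
  measurable_fun [set: T] Z -> 0 <= q < 1 -> (0 < N)%N ->
  (forall m : nat, (\int[P]_w cos (m%:R * (Z w - b)))%R <= q ^+ m) ->
  (P [set w | (N%:R * `|Z w - b| <= 1)%R] <=
     (2 / (N%:R * cos 1 ^+ 2 * (1 - q)))%:E)%E.
Proof.
move=> mZ q01 N0 H.
have cp : 0 < cos 1 :> R := cos1_gt0 R.
have Np : 0 < N%:R :> R by rewrite ltr0n.
have qp : 0 < 1 - q by case/andP: q01 => _; rewrite subr_gt0.
pose g m w := cos (m%:R * (Z w - b)).
have mg m : measurable_fun [set: T] (g m).
  apply: measurableT_comp.
    by apply: continuous_measurable_fun; exact: continuous_cos.
  by apply: measurable_funM => //; exact: measurable_funB.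
have ig m : P.-integrable [set: T] (EFin \o g m).
  by apply: (bounded_RV_integrable (c := 1)) => // w; exact: cos_max.
pose F w := \sum_(j < N) \sum_(k < N) g (j - k + (k - j))%N w.
pose E := [set w | N%:R * `|Z w - b| <= 1].
have mE : measurable E by apply: measurable_norm_le1; exact: measurable_funB.
have iF : P.-integrable [set: T]
    (fun w => \sum_(j < N) \sum_(k < N) (g (j - k + (k - j))%N w)%:E)%E.
  by apply: integrable_sum => // j _; apply: integrable_sum => // k _; exact: ig.
have FE w : (\sum_(j < N) \sum_(k < N) (g (j - k + (k - j))%N w)%:E)%E = (F w)%:E.
  by rewrite /F -sumEFin; apply: eq_bigr => j _; rewrite -sumEFin.
have F0 w : 0 <= F w by rewrite /F /g fejer_sumE addr_ge0 // sqr_ge0.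
have mF : measurable_fun [set: T] F.
  by apply: measurable_sum => j; apply: measurable_sum => k; exact: mg.
have a0 : 0 < (N%:R * cos 1) ^+ 2 :> R by rewrite exprn_gt0 // mulr_gt0.
have markovF : (((N%:R * cos 1) ^+ 2)%:E * P E <= \int[P]_w (F w)%:E)%E.
  have := @le_integral_abse _ _ _ P setT measurableT (EFin \o F) _
    (proj2 (measurable_EFinP _ _) mF) a0.
  under eq_integral do rewrite /= ger0_norm //.
   apply: le_trans; rewrite lee_pmul2l ?lte_fin //.
  apply: le_measure; rewrite ?inE //.
  - by apply: emeasurable_fun_c_infty => //; apply/measurable_EFinP; exact: measurableT_comp.
  - move=> w Ew; split=> //=; rewrite lee_fin ger0_norm //; exact: fejer_sum_ge.
have intF : (\int[P]_w (F w)%:E <= (2 * N%:R / (1 - q))%:E)%E.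
  under eq_integral do rewrite -FE.
  rewrite integral_sum //; last first.
    by move=> j; apply: integrable_sum => // k _; exact: ig.
  apply: (@le_trans _ _ (\sum_(j < N) \sum_(k < N) (q ^+ (j - k + (k - j))%N)%:E)%E).
    apply: lee_sum => j _; rewrite integral_sum //; last by move=> k; exact: ig.
    apply: lee_sum => k _; have := H (j - k + (k - j))%N.
    by rewrite /Rintegral -lee_fin fineK //; exact: (integrable_fin_num measurableT (ig _)).
  rewrite (eq_bigr (fun j : 'I_N => (\sum_(k < N) q ^+ (j - k + (k - j))%N)%:E)); last first.
    by move=> j _; rewrite sumEFin.
  rewrite sumEFin lee_fin.
  apply: (le_trans (sum_dist_le (f := fun m => q ^+ m) _ _)).
    by move=> m; rewrite exprn_ge0 //; case/andP: q01.
  by rewrite ler_wpM2l ?mulr_ge0 // sum_expr_le.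
have := le_trans markovF intF; rewrite -[P E]fineK ?fin_num_measure //.
rewrite -EFinM !lee_fin -ler_pdivlMl //; move=> /le_trans; apply.
rewrite exprMn [X in X <= _](_ : _ = 2 / (N%:R * cos 1 ^+ 2 * (1 - q))) //.
by field; rewrite !gt_eqF.
Qed.

End SmallBall.

Section IndependentPair.
Context (R : realType) d (T : measurableType d) (P : probability T R).

(** The product rule identifies the joint law with the product measure; integrating over the first
    coordinate, every section has probability at most [K]. *)
Lemma independent_pair_le (A B : {RV P >-> R}) (E : set (R * R)) (K : \bar R) :
  (forall U V : set R, measurable U -> measurable V ->
     P (A @^-1` U `&` B @^-1` V) = P (A @^-1` U) * P (B @^-1` V))%E ->
  measurable E -> (forall a, P [set w | E (a, B w)] <= K)%E ->
  (P [set w | E (A w, B w)] <= K)%E.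
Proof.
move=> AB mE EK.
have mAB : measurable_fun [set: T] (fun w => (A w, B w)) by exact: measurable_fun_pair.
pose AB' := mfun_Sub (mem_set mAB).
have ABE w : AB' w = (A w, B w) by [].
have -> : P [set w | E (A w, B w)] = distribution P AB' E by [].
rewrite -(@product_measure_unique _ _ _ _ _ (distribution P A) (distribution P B)) //.
rewrite /product_measure1 /=.
apply: (@le_trans _ _ (\int[distribution P A]_x K)%E).
  apply: ge0_le_integral => //.
  - exact: measurable_fun_xsection.
  move=> a _ /=; apply: le_trans (EK a).
  rewrite /distribution /pushforward.
  rewrite (_ : _ @^-1` _ = [set w | E (a, B w)]) //.
  by apply/seteqP; split => w /=; rewrite xsectionE.
rewrite integral_cst // [X in (_ * X)%E](_ : _ = 1%E) ?mule1 //.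
exact: (@probability_setT _ _ _ P).
Qed.

End IndependentPair.

Section CharFun.
Context (R : realType) d (T : measurableType d) (P : probability T R).

(** The left side is the real part of [exp(-iyb)] times the characteristic function, whose modulus
    is the right side; hence uniformity in [b]. *)
Lemma charfun_cos_le (Z : T -> R) (t y b : R) (psi : R[i]) :
  measurable_fun [set: T] Z -> charfun P Z y = cexp (t%:C * psi) ->
  \int[P]_w cos (y * (Z w - b)) <= expR (t * complex.Re psi).
Proof.
move=> mZ; have mc (f : R -> R) : continuous f ->
    measurable_fun [set: T] (fun w => f (y * Z w)).
  move=> cf; apply: (measurableT_comp (f := f)).
    exact: continuous_measurable_fun.
  exact: measurable_funM.
have ic : P.-integrable [set: T] (EFin \o (fun w => cos (y * Z w))).
  apply: (@bounded_RV_integrable _ _ _ _ _ 1) => [|w]; last exact: cos_max.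
  exact: mc (@continuous_cos R).
have isn : P.-integrable [set: T] (EFin \o (fun w => sin (y * Z w))).
  apply: (@bounded_RV_integrable _ _ _ _ _ 1) => [|w]; last exact: sin_max.
  exact: mc (@continuous_sin R).
have -> : \int[P]_w cos (y * (Z w - b)) =
  cos (y * b) * (\int[P]_w cos (y * Z w)) + sin (y * b) * (\int[P]_w sin (y * Z w)).
  rewrite -!RintegralZl // -RintegralD //; last 2 first.
  - exact: (integrableZl measurableT (cos (y * b)) ic).
  - exact: (integrableZl measurableT (sin (y * b)) isn).
  by congr fine; apply: eq_integral => w _; rewrite mulrBr cosB; congr (_%:E); ring.
rewrite /charfun /Cintegral.
under eq_Rintegral do rewrite cexp_iE /=.
under [X in _ +i* X]eq_Rintegral do rewrite cexp_iE /=.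
case: psi => p q; rewrite /cexp; simpc => -[-> ->] /=.
have -> : cos (y * b) * (expR (t * p) * cos (t * q)) +
   sin (y * b) * (expR (t * p) * sin (t * q)) = expR (t * p) * cos (y * b - t * q).
  by rewrite cosB; ring.
by rewrite ler_piMr ?expR_ge0 // cos_le1.
Qed.

End CharFun.

Section AeSubset.
Context (R : realType) d (T : measurableType d) (P : probability T R).

(** Serves to use [X 0 = 0], which holds only almost surely: the null set where the inclusion may
    fail is added to [B]. *)
Lemma ae_subset_le (Q : T -> Prop) (A B : set T) : measurable A -> measurable B ->
  {ae P, forall w, Q w} -> (forall w, Q w -> A w -> B w) -> (P A <= P B)%E.
Proof.
move=> mA mB [M [mM PM QM]] QAB.
apply: (@le_trans _ _ (P (B `|` M))).
  apply: le_measure; rewrite ?inE //; first exact: measurableU.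
  move=> w Aw; have [Qw|nQw] := pselect (Q w); first by left; exact: QAB.
  by right; exact: QM.
apply: (le_trans (measureU2 _ mB mM)).
by rewrite [X in (_ + X)%E](_ : _ = 0%E) ?adde0.
Qed.

End AeSubset.

(** With [kappa = (1 - cos 1) / 2], this is the constant of [small_ball_le] once [1 - q] is replaced
    by [h * kappa / 2]. *)
Definition small_ball_const (R : realType) : R := 4 / (cos 1 ^+ 2 * ((1 - cos 1) / 2)).

Lemma small_ball_const_ge0 (R : realType) : 0 <= small_ball_const R.
Proof.
by rewrite divr_ge0 // mulr_ge0 ?sqr_ge0 // divr_ge0 // onemcos_ge0.
Qed.

Section LevySmallBall.
Context (R : realType) d (T : measurableType d) (P : probability T R).
Context (phi : {measure set R -> \bar R}) (X : R -> {RV P >-> R}).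
Hypothesis hphi : dyadic_levy_measure phi.
Hypothesis hX : levy_process X.
Hypothesis hchar : forall t y : R, 0 <= t ->
  charfun P (X t) y = cexp (t%:C * levy_exponent phi y).

Let kappa : R := (1 - cos 1) / 2.
Let K : R := small_ball_const R.

Lemma levy_small_ball (h b : R) (N : nat) : 0 < h <= 1 -> (0 < N)%N ->
  (P [set w | (N%:R * `|X h w - b| <= 1)%R] <= (K / (N%:R * h))%:E)%E.
Proof.
move=> /andP[h0 h1] N0.
have c1 := cos1_lt1 R; have c0 := cos1_gt0 R.
have k0 : 0 < kappa by rewrite divr_gt0 // subr_gt0.
have k1 : kappa <= 1 by rewrite /kappa; lra.
have x0 : 0 < h * kappa by rewrite mulr_gt0.
have x1 : h * kappa <= 1 by rewrite mulr_ile1 // ltW.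
pose q := expR (- (h * kappa)).
have q01 : 0 <= q < 1 by rewrite expR_ge0 /= -expR0 ltr_expR oppr_lt0.
(* For [0 <= x <= 1], [exp(-x) <= 1 / (1 + x) <= 1 - x / 2]. *)
have q1 : h * kappa / 2 <= 1 - q.
  have e1 := expR_ge1Dx (h * kappa).
  have -> : q = (expR (h * kappa))^-1 by rewrite /q expRN.
  have : (expR (h * kappa))^-1 <= (1 + h * kappa)^-1.
    by rewrite lef_pV2 // posrE; lra.
  have : (1 + h * kappa)^-1 <= 1 - h * kappa / 2.
    by rewrite -div1r ler_pdivrMr; nra.
  lra.
apply: le_trans (small_ball_le (q := q) (b := b) _ _ N0 _) _ => //.
(* For [m = 0] the integrand is 1, the value of [q ^+ 0]; for [m > 0] the exponent bound gives
   [exp(-h kappa m)], which is [q ^+ m]. *)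
- move=> m; have [->|m0] := posnP m.
    rewrite expr0; under eq_Rintegral do rewrite mul0r cos0.
    rewrite Rintegral_cst // mul1r [X in fine X](_ : _ = 1%E) //.
    exact: (@probability_setT _ _ _ P).
  apply: le_trans (charfun_cos_le b _ (hchar m%:R (ltW h0))) _ => //.
  rewrite -expRM_natl ler_expR.
  rewrite [leRHS](_ : _ = h * - (kappa * m%:R)); last by ring.
  by apply: ler_wpM2l; [exact: ltW|exact: Re_levy_exponent_le].
rewrite lee_fin /K /small_ball_const -/kappa.
have Np : 0 < N%:R :> R by rewrite ltr0n.
have qp : 0 < 1 - q by case/andP: q01 => _; rewrite subr_gt0.
have -> : 4 / (cos 1 ^+ 2 * kappa) / (N%:R * h) = 2 / (N%:R * cos 1 ^+ 2 * (h * kappa / 2)).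
  by field; rewrite !gt_eqF.
rewrite ler_wpM2l // lef_pV2 ?posrE ?ler_pM2l ?mulr_gt0 ?exprn_gt0 ?divr_gt0 //.
by rewrite subr_gt0.
Qed.

Lemma levy_increment_small_ball (s h b : R) (N : nat) :
  0 <= s -> 0 < h <= 1 -> (0 < N)%N ->
  (P [set w | (N%:R * `|X (s + h) w - X s w - b| <= 1)%R] <= (K / (N%:R * h))%:E)%E.
Proof.
move=> s0 h01 N0; have h0 : 0 <= h by case/andP: h01 => /ltW.
pose B := [set x : R | N%:R * `|x - b| <= 1].
have mB : measurable B by apply: measurable_norm_le1; exact: measurable_funB.
rewrite [leLHS](levy_stationary_increments hX s0 h0 mB).
apply: le_trans (levy_small_ball b h01 N0).
apply: ae_subset_le (levy_start hX) _.
- by apply: measurable_norm_le1; apply: measurable_funB => //; exact: measurable_funB.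
- by apply: measurable_norm_le1; exact: measurable_funB.
by move=> w /= ->; rewrite subr0.
Qed.

Let Y (t : R) (w : T) : R := t^-1 * (X t w - t * log2 t).

(** Freezing the value of [X s], which is independent of [X t - X s], turns the event into a small
    ball for the increment with a shifted centre. *)
Lemma levy_average_small_ball (s t : R) (N : nat) :
  2^-1 <= s -> s < t -> t <= 1 -> (0 < N)%N ->
  (P [set w | (N%:R * `|Y t w - Y s w| <= 1)%R] <= (K / (N%:R * (t - s)))%:E)%E.
Proof.
move=> s2 st t1 N0.
have s0 : 0 < s by apply: lt_le_trans s2; rewrite invr_gt0.
have t0 : 0 < t by apply: lt_trans st.
have mY u : measurable_fun [set: T] (Y u).
  by apply: measurable_funM => //; exact: measurable_funB.
pose B : {RV P >-> R} := X s \- X 0.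
pose A : {RV P >-> R} := X t \- X s.
(* [g (B w, A w)] is [Y t w - Y s w] wherever [X 0 w = 0]; [B] subtracts [X 0] because independence
   is stated for increments. *)
pose g (z : R * R) : R := t^-1 * z.2 + (t^-1 - s^-1) * z.1 - (log2 t - log2 s).
pose E := [set z : R * R | N%:R * `|g z| <= 1].
have mE : measurable E.
  apply: measurable_norm_le1.
  apply: measurable_funB => //; apply: measurable_funD => //.
    by apply: measurable_funM.
  by apply: measurable_funM.
apply: (@le_trans _ _ (P [set w | E (B w, A w)])).
  apply: ae_subset_le (levy_start hX) _.
  - by apply: measurable_norm_le1; exact: measurable_funB.
  - rewrite -[X in measurable X]setTI.
    by apply: (measurable_fun_pair (f := B) (g := A)).
  move=> w X0 /=; rewrite /E /g /= X0 subr0.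
  rewrite [X in `|X|](_ : _ = t^-1 * (X t w - X s w) + (t^-1 - s^-1) * X s w
                              - (log2 t - log2 s)) //.
  by rewrite /Y; field; rewrite !gt_eqF.
apply: (independent_pair_le _ mE).
- move=> U V mU mV.
  (* The times [0, s, t], continued constantly to stay monotone at all indices. *)
  pose tt (n : nat) : R := if n is n'.+1 then if n' is _.+1 then t else s else 0.
  pose BB (i : 'I_2) : set R := if i == ord0 then U else V.
  have := @levy_independent_increments _ _ _ _ _ hX 2 tt (lexx _) _ BB _.
  rewrite 2!big_ord_recl big_ord0 mule1 /BB /=.
  have -> : \bigcap_(i in [set: 'I_2]) ((fun w => X (tt i.+1) w - X (tt i) w) @^-1`
      (if i == ord0 then U else V)) = B @^-1` U `&` A @^-1` V.
    apply/seteqP; split => [w H|w [H0 H1] [[|[|//]] ilt] _] //.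
    by split; [exact: (H ord0)|exact: (H (lift ord0 ord0))].
  apply.
  - by move=> [|[|i]] [|[|j]] //= _; rewrite ltW.
  - by move=> i; case: ifP.
move=> a.
(* The zero of [g (a, x)] in [x]; since [t <= 1], [|x - b| = t |g (a, x)| <= |g (a, x)|]. *)
pose b := t * ((log2 t - log2 s) - (t^-1 - s^-1) * a).
apply: (@le_trans _ _ (P [set w | N%:R * `|X (s + (t - s)) w - X s w - b| <= 1])).
  apply: le_measure; rewrite ?inE //.
  - rewrite -[X in measurable X]setTI.
    have mp : measurable_fun setT (fun w => (a, A w)) by exact: measurable_fun_pair.
    exact: mp measurableT _ mE.
  - by apply: measurable_norm_le1; apply: measurable_funB => //; exact: measurable_funB.
  move=> w; rewrite /E /= /g /= (addrC s) subrK; apply: le_trans.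
  rewrite ler_wpM2l //.
  rewrite [X in `|X|](_ : _ = t * (t^-1 * (X t w - X s w) + (t^-1 - s^-1) * a
                                   - (log2 t - log2 s))); last first.
    by rewrite /b; field; rewrite !gt_eqF.
  by rewrite normrM ger0_norm ?ler_piMl // ltW.
apply: levy_increment_small_ball => //; first exact: ltW.
by rewrite subr_gt0 st lerBlDr (le_trans t1) // lerDl ltW.
Qed.

End LevySmallBall.

(** * Counting close pairs of sample points *)

Section ClosePairs.
Context (R : realType).

(** Each dyadic block [2^n <= m < 2^(n+1)] has [2^n] terms of size at most [2^-n], so it adds at
    most 1. *)
Lemma sum_harmonic_expn2_le (n : nat) :
  \sum_(m < 2 ^ n) (m.+1%:R^-1 : R) <= n.+1%:R.
Proof.
elim: n => [|n IH]; first by rewrite expn0 big_ord1 invr1.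
rewrite -(big_mkord xpredT (fun m => m.+1%:R^-1)).
rewrite (big_cat_nat (n := 2 ^ n)) //=; last by rewrite leq_exp2l.
rewrite big_mkord -(natr1 n.+1) lerD //.
rewrite (@le_trans _ _ (\sum_(2 ^ n <= m < 2 ^ n.+1) (2 ^ n)%:R^-1)) //.
  rewrite !big_nat; apply: ler_sum => m /andP[m1 _].
  by rewrite lef_pV2 ?posrE ?ltr0n ?expn_gt0 // ler_nat ltnW.
rewrite sumr_const_nat expnS mul2n -addnn addnK -[leLHS]mulr_natr mulVf // pnatr_eq0 expn_eq0.
Qed.

Lemma nneseries_telescope_lty (C : R) : 0 <= C ->
  (\sum_(0 <= n <oo) (C / (n.+1%:R * n.+2%:R))%:E < +oo)%E.
Proof.
move=> C0; apply: (@le_lt_trans _ _ C%:E); last exact: ltry.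
apply: lime_le.
  by apply: is_cvg_nneseries => n _ _; rewrite lee_fin divr_ge0 // mulr_ge0.
apply: nearW => N; rewrite sumEFin lee_fin.
suff -> : \sum_(0 <= n < N) C / (n.+1%:R * n.+2%:R) = C * (1 - N.+1%:R^-1).
  by rewrite ler_piMr // gerBl invr_ge0.
elim: N => [|N IH]; first by rewrite big_geq // invr1 subrr mulr0.
rewrite big_nat_recr //= IH.
have e2 : N.+2%:R = N.+1%:R + 1 :> R by rewrite natr1.
have p : 0 < N.+1%:R :> R by rewrite ltr0n.
rewrite e2; field; rewrite gt_eqF //= gt_eqF //; lra.
Qed.

Context d (T : measurableType d) (P : probability T R).
Variables (Z : nat -> nat -> T -> R) (C : R).
Hypothesis C0 : 0 <= C.
Hypothesis mZ : forall n i, measurable_fun [set: T] (Z n i).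
Hypothesis Zclose : forall n (i j : nat), (i < 2 ^ n)%N -> (j < 2 ^ n)%N ->
  (P [set w | ((2 ^ n)%:R * `|Z n i w - Z n j w| <= 1)%R] <=
   (C / (i - j + (j - i)).+1%:R)%:E)%E.

(** Ordered pairs, diagonal included, as counted by the squared numbers of points per ball in a
    cover. *)
Definition close_pairs n w : R :=
  \sum_(i < 2 ^ n) \sum_(j < 2 ^ n) ((2 ^ n)%:R * `|Z n i w - Z n j w| <= 1)%R%:R.

Let E n (i j : nat) := [set w | (2 ^ n)%:R * `|Z n i w - Z n j w| <= 1].

Let mE n i j : measurable (E n i j).
Proof. by apply: measurable_norm_le1; exact: measurable_funB. Qed.

Let close_pairsE n w : close_pairs n w = \sum_(i < 2 ^ n) \sum_(j < 2 ^ n) \1_(E n i j) w.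
Proof.
apply: eq_bigr => i _; apply: eq_bigr => j _; rewrite indicE; congr (nat_of_bool _)%:R.
by apply/idP/idP; rewrite inE.
Qed.

Let mclose n : measurable_fun [set: T] (close_pairs n).
Proof.
rewrite (_ : close_pairs n = fun w => \sum_(i < 2 ^ n) \sum_(j < 2 ^ n) \1_(E n i j) w).
  by apply: measurable_sum => i; apply: measurable_sum => j; exact: measurable_indic.
by apply/funext => w; exact: close_pairsE.
Qed.

Lemma close_pairs_ge0 n w : 0 <= close_pairs n w.
Proof. by apply: sumr_ge0 => i _; apply: sumr_ge0. Qed.

(** Grouping pairs by index distance reduces the expectation to a harmonic sum of [2^n] terms. *)
Lemma integral_close_pairs_le n :
  (\int[P]_w (close_pairs n w)%:E <= (2 * C * (2 ^ n)%:R * n.+1%:R)%:E)%E.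
Proof.
under eq_integral do rewrite close_pairsE -sumEFin.
rewrite ge0_integral_sum //; first last.
- by move=> i w _; rewrite lee_fin sumr_ge0.
- move=> i; apply/measurable_EFinP; apply: measurable_sum => j; exact: measurable_indic.
apply: (@le_trans _ _
    (\sum_(i < 2 ^ n) (\sum_(j < 2 ^ n) C / (i - j + (j - i)).+1%:R)%:E)%E).
  apply: lee_sum => i _; under eq_integral do rewrite -sumEFin.
  rewrite ge0_integral_sum //; first last.
  - by move=> j; apply/measurable_EFinP; exact: measurable_indic.
  rewrite -sumEFin; apply: lee_sum => j _.
  by rewrite integral_indic // setIT; exact: Zclose.
rewrite sumEFin lee_fin.
apply: (le_trans (sum_dist_le (f := fun m => C / m.+1%:R) _ _)).
  by move=> m; rewrite divr_ge0.
rewrite -mulr_sumr.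
have := sum_harmonic_expn2_le n.
set s := \sum_(i < _) _ => sn.
rewrite [leRHS](_ : _ = 2 * (2 ^ n)%:R * (C * n.+1%:R)); last by ring.
by rewrite ler_wpM2l ?mulr_ge0 // ler_wpM2l.
Qed.

Let bound n : R := (2 ^ n)%:R * n.+1%:R ^+ 2 * n.+2%:R.

(* The threshold exceeds the mean by a factor [(n+1)(n+2)], whose inverses have a telescoping sum. *)
Lemma close_pairs_eventually_lt :
  {ae P, forall w, exists n0, forall n, (n0 <= n)%N ->
     close_pairs n w < (2 ^ n)%:R * n.+1%:R ^+ 2 * n.+2%:R}.
Proof.
pose F n := [set w | bound n <= close_pairs n w].
have mF n : measurable (F n).
  have -> : F n = setT `&` close_pairs n @^-1` `[bound n, +oo[.
    by apply/seteqP; split => w /=; rewrite /F /= in_itv /= andbT; [split|case].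
  exact: mclose.
have b0 n : 0 < bound n by rewrite /bound !mulr_gt0 ?exprn_gt0 // ltr0n expn_gt0.
have PF n : (P (F n) <= (2 * C / (n.+1%:R * n.+2%:R))%:E)%E.
  have : ((bound n)%:E * P (F n) <= (2 * C * (2 ^ n)%:R * n.+1%:R)%:E)%E.
    apply: le_trans (integral_close_pairs_le n).
    have := @le_integral_abse _ _ _ P setT measurableT (EFin \o close_pairs n) _
      (proj2 (measurable_EFinP _ _) (mclose n)) (b0 n).
    under eq_integral do rewrite /= ger0_norm ?close_pairs_ge0 //.
    apply: le_trans; rewrite lee_pmul2l ?lte_fin //.
    apply: le_measure; rewrite ?inE //.
    - apply: emeasurable_fun_c_infty => //; apply/measurable_EFinP; exact: measurableT_comp.
    - by move=> w Fw; split=> //=; rewrite lee_fin ger0_norm ?close_pairs_ge0.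
  rewrite -[P (F n)]fineK ?fin_num_measure //.
  rewrite -EFinM !lee_fin -ler_pdivlMl //; move=> /le_trans; apply.
  have p1 : 0 < n.+1%:R :> R by rewrite ltr0n.
  have p2 : 0 < n.+2%:R :> R by rewrite ltr0n.
  have p3 : 0 < (2 ^ n)%:R :> R by rewrite ltr0n expn_gt0.
  rewrite /bound [leLHS](_ : _ = 2 * C / (n.+1%:R * n.+2%:R)) //.
  by field; rewrite !gt_eqF.
have P0 : P (lim_sup_set F) = 0%E.
  apply: lim_sup_set_cvg0 => //.
  apply: le_lt_trans (nneseries_telescope_lty (mulr_ge0 (ler0n _ 2) C0)).
  by apply: lee_nneseries => [n _ _|n _]; [exact: measure_ge0|exact: PF].
exists (lim_sup_set F); split => //.
  by apply: bigcap_measurable => // k _; apply: bigcup_measurable.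
move=> w H n _; apply: contrapT => Hn; apply: H; exists n => m nm.
by rewrite ltNge; apply/negP => Fm; apply: Hn; exists m.
Qed.

End ClosePairs.

(** * Covering numbers and their relation to close pairs *)

Section BoxDimension.
Context (R : realType).
Implicit Types (F : set R) (delta : R).

Lemma ball_coverable_le (F : set R) delta (L : R) (n : nat) : 0 < delta ->
  (forall x, F x -> `|x| <= L) -> L < n%:R * delta -> ball_coverable F delta n.
Proof.
(* Centres of consecutive intervals of length [2 delta] starting at [-L]. *)
move=> d0 FL Ln; exists (fun i => - L + (i%:R * 2 + 1) * delta) => x Fx.
have := FL x Fx; rewrite ler_norml => /andP[x1 x2].
have y0 : 0 <= (x + L) / (2 * delta) by rewrite divr_ge0 ?mulr_ge0 // ?(ltW d0) //; lra.
pose i := Num.trunc ((x + L) / (2 * delta)).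
have iln : (i < n)%N.
  by rewrite truncn_lt_nat // ltr_pdivrMr ?mulr_gt0 //; lra.
exists (Ordinal iln) => //=.
rewrite closed_ballE //= /closed_ball_ /=.
have /andP[] := truncn_itv y0; rewrite -/i ler_pdivlMr ?mulr_gt0 // ltr_pdivrMr ?mulr_gt0 //.
rewrite -natr1 => i1 i2.
by rewrite ler_norml; apply/andP; split; lra.
Qed.

(** Boundedness yields a finite cover, so [get] returns the true minimum instead of its default
    value. *)
Lemma covering_numberP (F : set R) delta : 0 < delta -> bounded_set F ->
  ball_coverable F delta (covering_number F delta) /\
  forall m, ball_coverable F delta m -> (covering_number F delta <= m)%N.
Proof.
move=> d0 [L [_ FL]].
have FL' x : F x -> `|x| <= L + 1 by move=> Fx; apply: FL => //; rewrite ltrDl.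
have ex : exists n, `[< ball_coverable F delta n >].
  exists (Num.trunc (`|L + 1| / delta)).+1; apply/asboolP.
  apply: (ball_coverable_le d0 FL').
  rewrite -ltr_pdivrMr // (@le_lt_trans _ _ (`|L + 1| / delta)) //.
    by rewrite ler_wpM2r ?ler_norm // invr_ge0 ltW.
  by rewrite -truncn_lt_nat // divr_ge0 // ltW.
rewrite /covering_number.
apply: (@getPex _ [set n | ball_coverable F delta n /\
               forall m, ball_coverable F delta m -> (n <= m)%N]).
case: (ex_minnP ex) => n /asboolP cn mn; exists n; split => // m cm.
by apply: mn; apply/asboolP.
Qed.

(** Assign each point to a ball containing it. Two points of one ball are within [2 delta], hence
    close, so the close pairs number at least the sum of the squares of the ball counts [m k]. *)
Lemma coverable_close_pairs (F : set R) delta (N M : nat) (z : nat -> R) (r : R) :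
  0 < delta -> r * delta * 2 <= 1 -> 0 <= r -> ball_coverable F delta N ->
  (forall i, (i < M)%N -> F (z i)) ->
  M%:R ^+ 2 <= N%:R * \sum_(i < M) \sum_(j < M) (r * `|z i - z j| <= 1)%R%:R :> R.
Proof.
move=> d0 rd r0 [c Fc] Fz.
have H (i : 'I_M) : exists k, `|c k - z i| <= delta.
  have [k _] := Fc _ (Fz i (ltn_ord i)).
  by rewrite closed_ballE // => ck; exists k.
have [kap Hkap] := choice H.
pose m (k : 'I_N) : R := \sum_(i < M) (kap i == k)%:R.
have sm : \sum_k m k = M%:R.
  rewrite exchange_big /= (eq_bigr (fun=> 1)); last first.
    move=> i _; rewrite (bigD1 (kap i)) //= eqxx big1 ?addr0 // => k.
    by rewrite eq_sym => /negPf ->.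
  by rewrite sumr_const card_ord.
have sm2 : \sum_k m k ^+ 2 <= \sum_(i < M) \sum_(j < M) (r * `|z i - z j| <= 1)%R%:R.
  rewrite (eq_bigr (fun k => \sum_(i < M) \sum_(j < M)
      ((kap i == k)%:R * (kap j == k)%:R))); last first.
    by move=> k _; rewrite expr2 /m big_distrlr.
  rewrite exchange_big /=; apply: ler_sum => i _.
  rewrite exchange_big /=; apply: ler_sum => j _.
  rewrite (bigD1 (kap i)) //= eqxx mul1r big1 ?addr0; last first.
    by move=> k; rewrite eq_sym => /negPf ->; rewrite mul0r.
  case: eqP => [e|_]; last by rewrite ler0n.
  rewrite (_ : (_ <= 1) = true) //.
  have zz : `|z i - z j| <= delta * 2.
    have h1 := Hkap i; have h2 := Hkap j; rewrite e in h2.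
    rewrite (_ : z i - z j = (c (kap i) - z j) - (c (kap i) - z i)); last by ring.
    by rewrite (le_trans (ler_normB _ _)) // mulr_natr mulr2n lerD.
  by rewrite (le_trans _ rd) // -mulrA ler_wpM2l.
set S := \sum_(i < M) _ in sm2 *.
have N0 : 0 <= N%:R :> R by [].
(* Cauchy-Schwarz for [M = \sum_k m k], through the variance of [m]. *)
have : 0 <= \sum_(k < N) (N%:R * m k - M%:R) ^+ 2 by apply: sumr_ge0 => k _; exact: sqr_ge0.
rewrite (eq_bigr (fun k =>
  (N%:R ^+ 2 * m k ^+ 2 + (- (2 * N%:R * M%:R)) * m k) + M%:R ^+ 2)); last first.
  by move=> k _; ring.
rewrite big_split big_split /= sumr_const card_ord -!mulr_sumr sm -[M%:R ^+ 2 *+ N]mulr_natr.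
have [M0|Mpos] := posnP M.
  by rewrite M0 expr0n /= mulr_ge0 // (le_trans _ sm2) // sumr_ge0 // => k _; exact: sqr_ge0.
have Npos : (0 < N)%N by apply: leq_ltn_trans (ltn_ord (kap (Ordinal Mpos))).
have Np : 0 < N%:R :> R by rewrite ltr0n.
move=> h; have : N%:R * M%:R ^+ 2 <= N%:R * (N%:R * S).
  apply: (@le_trans _ _ (N%:R ^+ 2 * \sum_k m k ^+ 2)); last by rewrite expr2 -mulrA !ler_wpM2l.
  by move: h; lra.
by rewrite ler_pM2l.
Qed.

End BoxDimension.

(** * Logarithmic bounds on covering numbers and the limit *)

Section BoxDimensionLimit.
Context (R : realType).

Lemma ln_le_sub1 (x : R) : 0 < x -> ln x <= x - 1.
Proof. by move=> x0; have := @le_ln1Dx R (x - 1); rewrite addrCA subrr addr0; apply; lra. Qed.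

Lemma ln2_ge : 2^-1 <= ln 2 :> R.
Proof.
have := @ln_le_sub1 2^-1; rewrite invr_gt0 lnV ?posrE // => /(_ (ltr0n _ 2)); lra.
Qed.

Lemma ln2_gt0 : 0 < ln 2 :> R.
Proof. by apply: lt_le_trans ln2_ge; rewrite invr_gt0. Qed.

(** At most [L / delta + 1 <= (1 + L) / delta] balls suffice, and [ln (1 + L) <= L]. A point of [F]
    makes the covering number positive. *)
Lemma box_ratio_upper (F : set R) (L delta : R) : bounded_set F -> 0 <= L ->
  (forall x, F x -> `|x| <= L) -> 0 < delta < 1 -> (exists x, F x) ->
  ln (covering_number F delta)%:R <= - ln delta + L.
Proof.
move=> bF L0 FL /andP[d0 d1] [x Fx].
have [cF mF] := covering_numberP d0 bF.
set N := covering_number F delta in cF mF *.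
have N0 : (0 < N)%N by case: cF => c /(_ x Fx) [k _ _]; exact: leq_ltn_trans (ltn_ord k).
have Np : 0 < N%:R :> R by rewrite ltr0n.
have y0 : 0 <= L / delta by rewrite divr_ge0 // ltW.
have N1 : (N <= (Num.trunc (L / delta)).+1)%N.
  apply: mF; apply: (ball_coverable_le d0 FL).
  by rewrite -ltr_pdivrMr // -truncn_lt_nat.
have N2 : N%:R <= (1 + L) / delta.
  apply: (@le_trans _ _ (Num.trunc (L / delta)).+1%:R); first by rewrite ler_nat.
  rewrite -natr1 mulrDl addrC lerD //; last by rewrite truncn_le.
  by rewrite mul1r invf_ge1 // ltW.
have L1 : 0 < 1 + L by rewrite ltr_pwDl.
have : ln N%:R <= ln ((1 + L) / delta) by rewrite ler_ln ?posrE // divr_gt0.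
rewrite ln_div ?posrE // => /le_trans; apply; rewrite addrC lerD2l.
by apply: le_ln1Dx; lra.
Qed.

Variables (F : set R) (z : nat -> nat -> R) (n0 : nat).
Hypothesis bF : bounded_set F.
Hypothesis Fz : forall n i, (i < 2 ^ n)%N -> F (z n i).
Hypothesis few : forall n, (n0 <= n)%N ->
  \sum_(i < 2 ^ n) \sum_(j < 2 ^ n) ((2 ^ n)%:R * `|z n i - z n j| <= 1)%R%:R
  < (2 ^ n)%:R * n.+1%:R ^+ 2 * n.+2%:R :> R.

Lemma covering_number_lower (delta : R) (n : nat) : (n0 <= n)%N ->
  0 < delta -> (2 ^ n.+1)%:R * delta <= 1 ->
  (2 ^ n)%:R <= (covering_number F delta)%:R * n.+2%:R ^+ 3 :> R.
Proof.
move=> nn d0 nd.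
have [cF _] := covering_numberP d0 bF.
set N := covering_number F delta in cF *.
have Mp : 0 < (2 ^ n)%:R :> R by rewrite ltr0n expn_gt0.
have rd : (2 ^ n)%:R * delta * 2 <= 1.
  by apply: le_trans nd; rewrite expnS natrM; lra.
have := coverable_close_pairs d0 rd (ltW Mp) cF (Fz (n := n)).
have := few nn; set S := \sum_(i < _) _ => Sn MN.
have MN' : (2 ^ n)%:R ^+ 2 <= N%:R * ((2 ^ n)%:R * n.+1%:R ^+ 2 * n.+2%:R) :> R.
  by rewrite (le_trans MN) // ler_wpM2l // ltW.
rewrite -(ler_pM2l Mp) -expr2 (le_trans MN') //.
rewrite [leRHS](_ : _ = N%:R * ((2 ^ n)%:R * n.+2%:R ^+ 2 * n.+2%:R)); last by ring.
rewrite ler_wpM2l // ler_wpM2r // ler_wpM2l //.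
by rewrite ler_sqr ?nnegrE // ler_nat.
Qed.

Lemma box_ratio_lower (delta : R) : 0 < delta -> delta * (2 ^ n0.+1)%:R <= 1 ->
  - ln delta - 16 * Num.sqrt (- ln delta) - 3 <= ln (covering_number F delta)%:R.
Proof.
move=> d0 dn.
have u0 : 0 < delta^-1 by rewrite invr_gt0.
have un : (2 ^ n0.+1)%:R <= delta^-1 by rewrite -div1r ler_pdivlMr // mulrC.
set a := Num.trunc delta^-1.
have /andP[a1 a2] := truncn_itv (ltW u0).
rewrite -/a in a1 a2.
have an : (2 ^ n0.+1 <= a)%N by rewrite truncn_ge_nat // ltW.
have ap : (0 < a)%N by apply: leq_trans an; rewrite expn_gt0.
have kl : (n0.+1 <= trunc_log 2 a)%N.
  by rewrite -(trunc_expnK n0.+1 (p := 2)) // leq_trunc_log.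
(* The scale [n] satisfies [2^(n+1) <= 1 / delta < 2^(n+2)]. *)
case Ek : (trunc_log 2 a) kl => [//|n]; rewrite ltnS => nn.
have l1 : (2 ^ n.+1 <= a)%N by rewrite -Ek trunc_logP.
have l2 : (a < 2 ^ n.+2)%N by rewrite -Ek trunc_log_ltn.
have l1' : (2 ^ n.+1)%:R <= delta^-1 by rewrite (le_trans _ a1) // ler_nat.
have l2' : delta^-1 < (2 ^ n.+2)%:R by rewrite (lt_le_trans a2) // ler_nat.
have := @covering_number_lower delta n nn d0.
rewrite -ler_pdivlMr // div1r => /(_ l1').
set N := covering_number F delta => lower.
have p0 : 0 < (2 ^ n)%:R :> R by rewrite ltr0n expn_gt0.
have n2 : 0 < n.+2%:R ^+ 3 :> R by rewrite exprn_gt0.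
have Np : 0 < N%:R :> R.
  by have := lt_le_trans p0 lower; rewrite pmulr_lgt0.
have lnN : ln ((2 ^ n)%:R : R) <= ln N%:R + 3 * ln n.+2%:R.
  have : ln ((2 ^ n)%:R : R) <= ln (N%:R * n.+2%:R ^+ 3) by rewrite ler_ln ?posrE // mulr_gt0.
  by rewrite lnM ?posrE // lnXn // [3 * _]mulr_natl.
set x := - ln delta; have xE : x = ln delta^-1 by rewrite lnV ?posrE.
have ln2p := ln2_gt0.
have lnp k : ln ((2 ^ k)%:R : R) = ln 2 * k%:R.
  by rewrite natrX lnXn // mulr_natr.
have x2 : x <= ln 2 * n.+2%:R.
  by rewrite xE -lnp ler_ln ?posrE ?ltr0n ?expn_gt0 // ltW.
have x1 : ln 2 * n.+1%:R <= x.
  by rewrite xE -lnp ler_ln ?posrE ?ltr0n ?expn_gt0.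
have x0 : 0 <= x by rewrite (le_trans _ x1) // mulr_ge0 // ltW.
have ln22 : ln 2 <= 1 :> R by have := @ln_le_sub1 2 (ltr0n _ 2); lra.
set r := Num.sqrt x.
have r0 : 0 <= r := sqrtr_ge0 x.
have xr : x = r ^+ 2 by rewrite sqr_sqrtr.
(* From [ln 2 >= 1/2], [n + 1 <= 2 x], so [n + 2 <= 1 + 2 r^2]. The square form makes [ln (n + 2)]
   at most [4 r]: the polynomial loss costs [12 r], the two lost powers of 2 at most 2. *)
have nx : n.+2%:R <= (1 + 2 * r) ^+ 2.
  have l2g := ln2_ge.
  have : n.+1%:R * 2^-1 <= x by rewrite (le_trans _ x1) // mulrC ler_wpM2r.
  rewrite -natr1 xr; have n1 : 0 <= n.+1%:R :> R by [].
  nra.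
have lnn : ln n.+2%:R <= 4 * r.
  have : ln n.+2%:R <= ln ((1 + 2 * r) ^+ 2) by rewrite ler_ln ?posrE // exprn_gt0 //; lra.
  rewrite lnXn; last by lra.
  have := @le_ln1Dx R (2 * r); rewrite mulr2n; lra.
have : x - 2 <= ln ((2 ^ n)%:R : R).
  rewrite lnp; have : n.+2%:R = n%:R + 2 :> R by rewrite -natrD addn2.
  move=> e; rewrite e in x2; lra.
lra.
Qed.

Lemma box_ratio_cvg1 : box_ratio F delta @[delta --> 0^'+] --> (1 : R).
Proof.
have [M [_ FM]] := bF.
pose L := `|M + 1|.
have FL x : F x -> `|x| <= L.
  move=> Fx; apply: (@le_trans _ _ (M + 1)); last exact: ler_norm.
  by apply: FM => //; rewrite ltrDl.
have L0 : 0 <= L by exact: normr_ge0.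
have exF : exists x, F x by exists (z 0%N 0%N); exact: Fz.
apply/cvgrPdist_le => /= e e0.
(* For [x = - ln delta > A] and [r = sqrt x], both [r > 1] and [20 + L <= r e]; the error, at most
   [16 r + 3 + L <= (20 + L) r], is then at most [e x]. *)
pose A := Num.max 1 (((20 + L) / e) ^+ 2).
near=> delta.
have d0 : 0 < delta by near: delta; exact: nbhs_right_gt.
have d1 : delta < 1 by near: delta; exact: nbhs_right_lt.
have dn : delta * (2 ^ n0.+1)%:R <= 1.
  rewrite -ler_pdivlMr ?ltr0n ?expn_gt0 // div1r; apply: ltW.
  by near: delta; apply: nbhs_right_lt; rewrite invr_gt0 ltr0n expn_gt0.
have dA : ln delta < - A.
  near: delta; have /cvgrNyPlt := @lnNy R; exact.
have lo := box_ratio_lower d0 dn.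
have d01 : 0 < delta < 1 by rewrite d0.
have up := box_ratio_upper bF L0 FL d01 exF.
rewrite /box_ratio.
set x := - ln delta in lo up *.
set y := ln _ in lo up *.
have xA : A < x by rewrite ltrNr.
have [x1 xe] : 1 < x /\ ((20 + L) / e) ^+ 2 < x.
  by move: xA; rewrite gt_max => /andP[].
have x0 : 0 < x by lra.
set r := Num.sqrt x in lo.
have r0 : 0 < r by rewrite sqrtr_gt0.
have xr : x = r ^+ 2 by rewrite sqr_sqrtr // ltW.
have r1 : 1 < r by rewrite -sqrtr1 ltr_sqrt.
have re : (20 + L) / e <= r.
  have Le : 0 <= (20 + L) / e by rewrite divr_ge0 ?addr_ge0 // ltW.
  by rewrite -(ger0_norm Le) -sqrtr_sqr ler_sqrt ltW.
have re' : 20 + L <= r * e by rewrite -ler_pdivrMr.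
have -> : 1 - y / x = (x - y) / x by field; rewrite gt_eqF.
rewrite normrM normfV (gtr0_norm x0) ler_pdivrMr // ler_norml.
have rre : (20 + L) * r <= e * x by rewrite xr; nra.
by apply/andP; split; nra.
Unshelve. all: by end_near.
Qed.

End BoxDimensionLimit.

(** * Boundedness of càdlàg paths on compact intervals *)

Section CadlagBounded.
Context (R : realType).

(** Near [t], values on the right are within 1 of [f t], values on the left within 1 of the left
    limit. *)
Lemma cadlag_locally_bounded (f : R -> R) (t : R) : cadlag f -> 0 < t ->
  exists K, \forall s \near t, `|f s| <= K.
Proof.
move=> [fr fl] t0.
have /cvg_ex [l fl'] := fl _ t0.
have /cvgrPdist_le /(_ 1 ltr01) nr := fr _ (ltW t0).
have /cvgrPdist_le /(_ 1 ltr01) nl := fl'.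
exists (`|f t| + `|l| + 1).
have bd (a b : R) : `|a - b| <= 1 -> `|b| <= `|a| + 1.
  by move=> ab; have := lerB_dist b a; rewrite distrC; lra.
have Pt : `|f t| <= `|f t| + `|l| + 1 by rewrite -addrA lerDl addr_ge0.
have nr' : \forall s \near t^'+, `|f s| <= `|f t| + `|l| + 1.
  apply: filterS nr => s /bd; have := normr_ge0 l; lra.
have nl' : \forall s \near t^'-, `|f s| <= `|f t| + `|l| + 1.
  apply: filterS nl => s /bd; have := normr_ge0 (f t); lra.
have : \forall s \near t, s != t -> `|f s| <= `|f t| + `|l| + 1.
  near=> s => st.
  have [ts|st'] := ltP t s.
    by move: ts; near: s; exact: nr'.
  have {}st' : s < t by rewrite lt_neqAle st.
  by move: st'; near: s; exact: nl'.
apply: filterS => s Hs; have [->|] := eqVneq s t => //.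
Unshelve. all: by end_near.
Qed.

(** Compactness merges the local bounds; the near-covering form is used with the filter of bounds
    [K] tending to [+oo]. *)
Lemma cadlag_bounded (f : R -> R) (a b : R) : cadlag f -> 0 < a ->
  exists K, forall s, a <= s <= b -> `|f s| <= K.
Proof.
move=> cf a0.
have /compact_near_coveringP := @segment_compact R a b.
move=> /(_ R (+oo : set_system R) (fun K s => `|f s| <= K) _).
case.
- move=> t; rewrite /= in_itv /= => /andP[at_ _].
  have [K HK] := cadlag_locally_bounded cf (lt_le_trans a0 at_).
  near=> s K' => /=.
  apply: (@le_trans _ _ K).
    by near: s.
  by near: K'; apply: nbhs_pinfty_ge; exact: num_real.
- move=> K [_ H]; exists (K + 1) => s sab.
  by apply: (H (K + 1)); rewrite ?ltrDl //= in_itv.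
Unshelve. all: by end_near.
Qed.

End CadlagBounded.

(** * Dimension of the range of [Y] *)

Theorem mainTheorem2 (R : realType) (d : measure_display)
    (T : measurableType d) (P : probability T R)
    (phi : {measure set R -> \bar R}) (X : R -> {RV P >-> R})
    (hphi : dyadic_levy_measure phi)
    (hX : levy_process X)
    (hchar : forall t y : R, 0 <= t ->
       charfun P (X t) y = cexp (t%:C * levy_exponent phi y)) :
  let Y (t : R) (w : T) : R := t^-1 * (X t w - t * log2 t) in
  {ae P, forall w,
     let F := [set Y t w | t in `[2^-1, 1]] in
     box_dim_exists F /\ box_dim F = 1}.
Proof.
move=> Y.
pose K := small_ball_const R; have K0 : 0 <= K := small_ball_const_ge0 R.
(* For [i < 2^n], the left endpoints of the [2^n] equal pieces of [[1/2, 1]]. *)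
pose s (n i : nat) : R := 2^-1 + i%:R / (2 ^ n.+1)%:R.
have p2 n : 0 < (2 ^ n)%:R :> R by rewrite ltr0n expn_gt0.
have s_ge n i : 2^-1 <= s n i by rewrite lerDl divr_ge0.
have s_le n i : (i < 2 ^ n)%N -> s n i <= 1.
  move=> ilt; have -> : 1 = 2^-1 + 2^-1 :> R by lra.
  rewrite lerD2l ler_pdivrMr // expnS natrM mulrA mulVf // mul1r.
  by rewrite ler_nat ltnW.
have mY n i : measurable_fun [set: T] (Y (s n i)).
  by apply: measurable_funM => //; exact: measurable_funB.
(* At index distance [m >= 1] the small-ball bound is [2 K / m <= 4 K / (m + 1)]; the extra 1 covers
   the diagonal, where only the bound 1 is available. *)
have close n (i j : nat) : (i < 2 ^ n)%N -> (j < 2 ^ n)%N ->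
  (P [set w | ((2 ^ n)%:R * `|Y (s n i) w - Y (s n j) w| <= 1)%R] <=
   ((4 * K + 1) / (i - j + (j - i)).+1%:R)%:E)%E.
  wlog ij : i j / (j <= i)%N => [H|] ilt jlt.
    have [ji|/ltnW ij] := leqP j i; first exact: H.
    rewrite addnC (_ : [set w | _] =
      [set w | (2 ^ n)%:R * `|Y (s n j) w - Y (s n i) w| <= 1]); first exact: H.
    by apply/seteqP; split => w /=; rewrite distrC.
  rewrite (eqP ij) addn0.
  move: ij; rewrite leq_eqVlt => /predU1P[->|ji].
    rewrite subnn divr1; apply: (le_trans (probability_le1 _ _)).
      by apply: measurable_norm_le1; exact: measurable_funB.
    by rewrite lee_fin; lra.
  have ss : s n j < s n i by rewrite ltrD2l ltr_pM2r ?invr_gt0 // ltr_nat.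
  apply: le_trans (levy_average_small_ball hphi hX hchar (s_ge n j) ss (s_le n i ilt) _) _.
    by rewrite expn_gt0.
  rewrite lee_fin -/K.
  have m0 : 0 < (i - j)%:R :> R by rewrite ltr0n subn_gt0.
  have m1 : 1 <= (i - j)%:R :> R by rewrite ler1n subn_gt0.
  have -> : s n i - s n j = (i - j)%:R / (2 * (2 ^ n)%:R).
    by rewrite /s natrB ?(ltnW ji) // -natrM -expnS; ring.
  have -> : K / ((2 ^ n)%:R * ((i - j)%:R / (2 * (2 ^ n)%:R))) = 2 * K / (i - j)%:R.
    by field; rewrite !gt_eqF.
  rewrite -natr1 ler_pdivrMr // mulrAC ler_pdivlMr; last lra.
  nra.
have C0 : 0 <= 4 * K + 1 by lra.
have few_pairs := close_pairs_eventually_lt C0 mY close.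
apply: filterS2 (levy_cadlag hX) few_pairs => w cw [n0 few].
set F := [set _ | _ in _].
have bF : bounded_set F.
  have h2 : 0 < 2^-1 :> R by rewrite invr_gt0.
  have [M HM] := cadlag_bounded 1 cw h2.
  (* On [[1/2, 1]], [t^-1 <= 2] and [|log2 t| <= 1]. *)
  exists (2 * M + 1); split; first exact: num_real.
  move=> c Mc _ [t + <-]; rewrite /= in_itv /= => /andP[t1 t2].
  have t0 : 0 < t by lra.
  have Xt := HM t; rewrite t1 t2 in Xt; have {}Xt := Xt isT.
  apply: (le_trans _ (ltW Mc)).
  have -> : Y t w = t^-1 * X t w - log2 t by rewrite /Y; field; rewrite gt_eqF.
  rewrite (le_trans (ler_normB _ _)) // lerD //.
    rewrite normrM ger0_norm ?invr_ge0 ?(ltW t0) // ler_pM ?invr_ge0 ?(ltW t0) //.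
    by rewrite -[leRHS]invrK lef_pV2 ?posrE.
  have l2 := ln2_gt0 R.
  rewrite /log2 normrM normfV (gtr0_norm l2) ler_pdivrMr // mul1r ler0_norm ?ln_le0 //.
  by rewrite -lnV ?posrE // ler_ln ?posrE ?invr_gt0 // -[leRHS]invrK lef_pV2 ?posrE ?invr_gt0.
have Fz n i : (i < 2 ^ n)%N -> F (Y (s n i) w).
  by move=> ilt; exists (s n i) => //=; rewrite in_itv /= s_ge s_le.
have cv := box_ratio_cvg1 bF Fz few.
split; last exact: cvg_lim cv.
by split => //; apply/cvg_ex; exists 1.
Qed.
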